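(* Let $(M,\varphi_i,\xi_i,\eta_i,g)$, $i=1,2,3$, be a $3$-$(\alpha,\delta)$-Sasaki manifold. The torsion of its canonical connection $\nabla$ is given by $$T=\sum_{i=1}^3\eta_i\wedge d\eta_i+8(\delta-\alpha)\,\eta_{123}=2\alpha\sum_{i=1}^3\eta_i\wedge\Phi_i^{\mathcal H}+2(\delta-4\alpha)\,\eta_{123}$$ and satisfies $\nabla T=0$ as well as $$dT=4\alpha^2\sum_{i=1}^3\Phi_i\wedge\Phi_i+8\alpha(\delta-\alpha)\sum_{(i,j,k)}\Phi_i\wedge\eta_{jk}=4\alpha^2\sum_{i=1}^3\Phi_i^{\mathcal H}\wedge\Phi_i^{\mathcal H}+8\alpha(\delta-2\alpha)\sum_{(i,j,k)}\Phi_i^{\mathcal H}\wedge\eta_{jk},$$ where $\sum_{(i,j,k)}$ denotes the sum over all even permutations $(i,j,k)$ of $(1,2,3)$.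
   Context: An almost contact metric structure $(\varphi,\xi,\eta,g)$ consists of a $(1,1)$-tensor field $\varphi$, a vector field $\xi$, a $1$-form $\eta$ and a Riemannian metric $g$ with $\varphi^2=-I+\eta\otimes\xi$, $\eta(\xi)=1$, $g(\varphi X,\varphi Y)=g(X,Y)-\eta(X)\eta(Y)$. Its fundamental form is $\Phi(X,Y)=g(X,\varphi Y)$. An almost $3$-contact metric manifold $(M,\varphi_i,\xi_i,\eta_i,g)$, $i=1,2,3$, is a manifold of dimension $4n+3$ with three almost contact metric structures with the same $g$ such that, for every even permutation $(i,j,k)$ of $(1,2,3)$, $\varphi_k=\varphi_i\varphi_j-\eta_j\otimes\xi_i=-\varphi_j\varphi_i+\eta_i\otimes\xi_j$, $\xi_k=\varphi_i\xi_j=-\varphi_j\xi_i$, $\eta_k=\eta_i\circ\varphi_j=-\eta_j\circ\varphi_i$. The fundamental form of the $i$-th structure is denoted $\Phi_i$. The manifold is $3$-$(\alpha,\delta)$-Sasaki if $d\eta_i=2\alpha\Phi_i+2(\alpha-\delta)\eta_j\wedge\eta_k$ for every even permutation $(i,j,k)$ of $(1,2,3)$, with real constants $\alpha\neq0$, $\delta$. Notation: $\eta_{jk}=\eta_j\wedge\eta_k$, $\eta_{123}=\eta_1\wedge\eta_2\wedge\eta_3$; $\Phi_i^{\mathcal H}=\Phi_i+\eta_{jk}$ for even permutations $(i,j,k)$, i.e. the horizontal part of $\Phi_i$ (which vanishes upon contraction with $\xi_1,\xi_2,\xi_3$). A metric connection $\nabla$ has skew torsion if $T(X,Y,Z)=g(T(X,Y),Z)$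 is a $3$-form. The canonical connection of a $3$-$(\alpha,\delta)$-Sasaki manifold is the unique metric connection $\nabla$ with skew torsion such that $\nabla_X\varphi_i=\beta(\eta_k(X)\varphi_j-\eta_j(X)\varphi_k)$ for all vector fields $X$ and every even permutation $(i,j,k)$ of $(1,2,3)$, where $\beta=2(\delta-2\alpha)$ (it is known to exist). Conventions: $d\eta(X,Y)=X(\eta(Y))-Y(\eta(X))-\eta([X,Y])$, $(\eta\wedge\zeta)(X,Y)=\eta(X)\zeta(Y)-\eta(Y)\zeta(X)$, and analogously in general (e.g. $(\eta\wedge\Phi)(X,Y,Z)=\eta(X)\Phi(Y,Z)+\eta(Y)\Phi(Z,X)+\eta(Z)\Phi(X,Y)$). *)

(* Defs.v *)
From HB Require Import structures.
From mathcomp Require Import all_boot all_order all_algebra.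
From mathcomp Require Import all_classical all_reals all_analysis.
From mathcomp Require Import ring.
Set Implicit Arguments.
Unset Strict Implicit.
Unset Printing Implicit Defensive.
Import Order.TTheory GRing.Theory Num.Theory.
Import numFieldNormedType.Exports.
Local Open Scope classical_set_scope.
Local Open Scope ring_scope.

(** * Smooth maps between normed modules *)

Section smooth_maps.
Context {R : realType} {V W : normedModType R}.
Implicit Types (U : set V) (f g : V -> W).

(* Meant for open U and V, W finite-dimensional, where it is the usual class
   C^k (continuous directional derivatives up to order k). *)
Fixpoint Ck_on (k : nat) U f : Prop :=
  (forall x, U x -> {for x, continuous f}) /\
  if k is k'.+1 then
    forall v, (forall x, U x -> derivable f x v) /\
              Ck_on k' U (fun x => 'D_v f x)
  else True.

Definition smooth_on U f : Prop := forall k, Ck_on k U f.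

Lemma Ck_on_eq k U f g : open U -> (forall x, U x -> f x = g x) ->
  Ck_on k U f -> Ck_on k U g.
Proof.
move=> oU; elim: k f g => [|k IH] f g fg.
all: have nfg x : U x -> \near x, f x = g x
  by move=> xU; have := open_nbhs_nbhs (conj oU xU); apply: filterS.
all: have cfg : (forall x, U x -> {for x, continuous f}) ->
     (forall x, U x -> {for x, continuous g}).
1,3: by move=> cf x xU; have := cf x xU; rewrite /prop_for /continuous_at -fg//;
        apply: cvg_trans; apply: near_eq_cvg; exact: nfg.
- by case=> /cfg.
- case=> /cfg cg Df; split=> // v; have [df Ckf] := Df v; split=> [x xU|].
    exact: near_eq_derivable (nfg x xU) (df x xU).
  apply: IH Ckf => x xU; exact: near_eq_derive (nfg x xU).
Qed.

Lemma Ck_onW k U f : Ck_on k.+1 U f -> Ck_on k U f.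
Proof.
elim: k f => [|k IH] f [cf Df]; split=> // v.
by have [df /IH] := Df v.
Qed.

End smooth_maps.

Section smooth_algebra.
Context {R : realType} {V : normedModType R}.
Implicit Types (U : set V) (f g : V -> R^o).

Lemma Ck_on_cst k U (a : R^o) : Ck_on k U (cst a : V -> R^o).
Proof.
elim: k a => [|k IH] a.
  by split=> // x _; exact: cst_continuous.
split=> [x _|v]; first exact: cst_continuous.
split=> [x _|]; first exact: derivable_cst.
suff -> : (fun x => 'D_v (cst a : V -> R^o) x) = cst 0 by exact: IH.
by apply/funext => x; rewrite derive_cst.
Qed.

Lemma Ck_onB k U f g : open U -> Ck_on k U f -> Ck_on k U g ->
  Ck_on k U (f - g).
Proof.
move=> oU; elim: k f g => [|k IH] f g [cf Df] [cg Dg].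
  by split=> // x xU; apply: continuousB; [exact: cf|exact: cg].
split=> [x xU|v]; first by apply: continuousB; [exact: cf|exact: cg].
have [[df Ckf] [dg Ckg]] := (Df v, Dg v); split=> [x xU|].
  by apply: derivableB; [exact: df|exact: dg].
apply: Ck_on_eq (IH _ _ Ckf Ckg) => // x xU.
by rewrite deriveB; [|exact: df|exact: dg].
Qed.

Lemma Ck_onD k U f g : open U -> Ck_on k U f -> Ck_on k U g ->
  Ck_on k U (f + g).
Proof.
move=> oU Cf Cg; rewrite -[g]opprK; apply: Ck_onB => //.
by rewrite -sub0r; apply: Ck_onB => //; exact: Ck_on_cst.
Qed.

Lemma Ck_onM k U f g : open U -> Ck_on k U f -> Ck_on k U g ->
  Ck_on k U (f * g).
Proof.
move=> oU; elim: k f g => [|k IH] f g Cf Cg.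
  have [[cf _] [cg _]] := (Cf, Cg).
  by split=> // x xU; apply: continuousM; [exact: cf|exact: cg].
have [[cf Df] [cg Dg]] := (Cf, Cg).
split=> [x xU|v]; first by apply: continuousM; [exact: cf|exact: cg].
have [[df Ckf] [dg Ckg]] := (Df v, Dg v); split=> [x xU|].
  by apply: derivableM; [exact: df|exact: dg].
have := Ck_onD oU (IH _ _ (Ck_onW Cf) Ckg) (IH _ _ (Ck_onW Cg) Ckf).
by apply: Ck_on_eq => // x xU; rewrite deriveM; [|exact: df|exact: dg].
Qed.

End smooth_algebra.

(** * Smooth manifolds and smooth functions *)

(* [chart_inv] is only relevant on the image of the chart. *)
Record chart (R : realType) (d : nat) (M : topologicalType) := Chart {
  chart_dom : set M;
  chart_map :> M -> 'rV[R]_d;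
  chart_inv : 'rV[R]_d -> M;
  chart_dom_open : open chart_dom;
  chart_cod_open : open (chart_map @` chart_dom);
  chart_mapK : forall p, chart_dom p -> chart_inv (chart_map p) = p;
  chart_map_continuous :
    forall p, chart_dom p -> {for p, continuous chart_map};
  chart_inv_continuous :
    forall x, (chart_map @` chart_dom) x -> {for x, continuous chart_inv} }.

Record manifold (R : realType) (d : nat) := Manifold {
  carrier :> topologicalType;
  manifold_hausdorff : hausdorff_space carrier;
  manifold_second_countable : @second_countable carrier;
  atlas : set (chart R d carrier);
  atlas_cover : forall p : carrier, exists2 c, atlas c & chart_dom c p;
  atlas_compatible : forall c c', atlas c -> atlas c' ->
    smooth_on (c @` (chart_dom c `&` chart_dom c')) (c' \o chart_inv c) }.
Arguments atlas {R d} M : rename.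

Section smooth_functions.
Context (R : realType) (d : nat) (M : manifold R d).
Implicit Types f g : M -> R^o.

Definition is_smooth f : Prop :=
  forall c, atlas M c -> smooth_on (c @` chart_dom c) (f \o chart_inv c).

Definition smooth : {pred M -> R^o} := fun f => `[< is_smooth f >].

Lemma smoothP f : reflect (is_smooth f) (f \in smooth).
Proof. exact: asboolP. Qed.

Lemma cst_smooth (a : R^o) : cst a \in smooth.
Proof. by apply/smoothP => c _ k; exact: Ck_on_cst. Qed.

Lemma smooth_subring_closed : subring_closed smooth.
Proof.
split=> [|f g /smoothP sf /smoothP sg|f g /smoothP sf /smoothP sg].
- exact: cst_smooth.
- apply/smoothP => c ac k.
  by apply: Ck_onB; [exact: chart_cod_open|exact: sf|exact: sg].
- apply/smoothP => c ac k.
  by apply: Ck_onM; [exact: chart_cod_open|exact: sf|exact: sg].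
Qed.

Lemma smooth_scaler_closed : scaler_closed smooth.
Proof.
move=> a f sf; have -> : a *: f = cst a * f by apply/funext.
by have [_ _ sM] := smooth_subring_closed; apply: sM; first exact: cst_smooth.
Qed.

HB.instance Definition _ :=
  GRing.isSubringClosed.Build _ smooth smooth_subring_closed.
HB.instance Definition _ :=
  GRing.isScaleClosed.Build _ _ smooth smooth_scaler_closed.

Record smooth_fun := SmoothFun {
  smooth_val :> M -> R^o;
  smooth_valP : smooth_val \in smooth }.

HB.instance Definition _ := [isSub for smooth_val].
HB.instance Definition _ := [Choice of smooth_fun by <:].
HB.instance Definition _ := 
  GRing.SubChoice_isSubComPzRing.Build _ _ smooth_fun (subringClosedP _).
HB.instance Definition _ := [SubZmodule_isSubLmodule of smooth_fun by <:].

End smooth_functions.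

(** * Vector fields, as derivations of the algebra of smooth functions *)

Section vector_fields.
Context (R : realType) (d : nat) (M : manifold R d).
Local Notation A := (smooth_fun M).
Implicit Types D : A -> A^o.

Definition is_derivation D : Prop :=
  [/\ forall f g, D (f + g) = D f + D g,
      forall (a : R) f, D (a *: f) = a *: (D f : A)
    & forall f g, D (f * g) = f * D g + g * D f].

Definition derivation : {pred A -> A^o} := fun D => `[< is_derivation D >].

Lemma derivationP D : reflect (is_derivation D) (D \in derivation).
Proof. exact: asboolP. Qed.

Lemma derivation_submod_closed : submod_closed derivation.
Proof.
split=> [|h D E /derivationP[DD DZ DM] /derivationP[ED EZ EM]].
  apply/derivationP; split=> [f g|a f|f g].
  - by apply/esym; exact: addr0.
  - by rewrite [RHS](_ : _ = a *: (0 : A)) // scaler0.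
  - by rewrite [RHS](_ : _ = f * 0 + g * 0) // !mulr0 addr0.
have hDE f : (h *: D + E) f = h * (D f : A) + E f by [].
apply/derivationP; split=> [f g|a f|f g]; rewrite !hDE.
- by rewrite DD ED mulrDr addrACA.
- rewrite DZ EZ scalerDr; congr (_ + _); apply/val_inj/funext => p /=.
  exact: mulrCA.
- by rewrite DM EM !mulrDr !(mulrCA h) addrACA.
Qed.

HB.instance Definition _ :=
  GRing.isSubmodClosed.Build _ _ derivation derivation_submod_closed.

Record vfield := VField {
  vfield_val :> A -> A^o;
  vfield_valP : vfield_val \in derivation }.

HB.instance Definition _ := [isSub for vfield_val].
HB.instance Definition _ := [Choice of vfield by <:].
HB.instance Definition _ := [SubChoice_isSubLmodule of vfield by <:].

Lemma lie_subproof (X Y : vfield) :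
  (fun f => (X (Y f) : A) - (Y (X f) : A) : A^o) \in derivation.
Proof.
have /derivationP[XD XZ XM] := vfield_valP X.
have /derivationP[YD YZ YM] := vfield_valP Y.
apply/derivationP; split=> [f g|a f|f g].
- by rewrite YD XD XD YD opprD addrACA.
- rewrite YZ XZ XZ YZ.
  by apply/esym; exact: (scalerBr a (X (Y f) : A) (Y (X f) : A)).
- rewrite YM XM XD YD !XM !YM.
  have aux (u v xu xv yu yv a b a' b' : A) :
    u * a + yv * xu + (v * b + yu * xv) - (u * a' + xv * yu + (v * b' + xu * yv))
    = u * (a - a') + v * (b - b').
    by ring.
  exact: aux.
Qed.

Definition lie (X Y : vfield) : vfield := VField (lie_subproof X Y).

End vector_fields.

(** * Tensor calculus *)

(* Tensor fields are C^oo(M)-multilinear maps on vector fields. Conventions for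
   forms: no factorials, i.e. (a /\ b) is the sum over shuffles and
   d a (X, Y) = X (a Y) - Y (a X) - a [X, Y]. *)
Section tensors.
Context (R : realType) (d : nat) (M : manifold R d).
Local Notation A := (smooth_fun M).
Local Notation V := (vfield M).
Implicit Types X Y Z W : V.

Definition wedge11 (a b : V -> A) : V -> V -> A :=
  fun X Y => a X * b Y - a Y * b X.

Definition wedge12 (a : V -> A) (b : V -> V -> A) : V -> V -> V -> A :=
  fun X Y Z => a X * b Y Z + a Y * b Z X + a Z * b X Y.

Definition wedge22 (a b : V -> V -> A) : V -> V -> V -> V -> A :=
  fun X Y Z W =>
    a X Y * b Z W - a X Z * b Y W + a X W * b Y Z
    + a Y Z * b X W - a Y W * b X Z + a Z W * b X Y.

Definition ext1 (a : V -> A) : V -> V -> A :=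
  fun X Y => X (a Y) - Y (a X) - a (lie X Y).

Definition ext3 (a : V -> V -> V -> A) : V -> V -> V -> V -> A :=
  fun X Y Z W =>
    X (a Y Z W) - Y (a X Z W) + Z (a X Y W) - W (a X Y Z)
    - a (lie X Y) Z W + a (lie X Z) Y W - a (lie X W) Y Z
    - a (lie Y Z) X W + a (lie Y W) X Z - a (lie Z W) X Y.

Record is_3form (a : V -> V -> V -> A) : Prop := Is3Form {
  form3_linear1 : forall Y Z, scalar (fun X => a X Y Z);
  form3_linear2 : forall X Z, scalar (fun Y => a X Y Z);
  form3_linear3 : forall X Y, scalar (fun Z => a X Y Z);
  form3_alt12 : forall X Z, a X X Z = 0;
  form3_alt23 : forall X Y, a X Y Y = 0 }.

(* [metric_eq0]: the value of X at p, a derivation at p, vanishes. *)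
Record riemannian_metric := RiemannianMetric {
  metric :> V -> V -> A;
  metric_linear : forall X, scalar (metric X);
  metric_sym : forall X Y, metric X Y = metric Y X;
  metric_ge0 : forall X (p : M), 0 <= metric X X p;
  metric_eq0 : forall X (p : M),
    metric X X p = 0 -> forall f : A, (X f : A) p = 0 }.

Record connection := Connection {
  nabla :> V -> V -> V;
  nabla_linear : forall Y, linear (fun X => nabla X Y);
  nablaD : forall X Y Z, nabla X (Y + Z) = nabla X Y + nabla X Z;
  nabla_leibniz : forall X (f : A) Y,
    nabla X (f *: Y) = (X f : A) *: Y + f *: nabla X Y }.

Definition is_metric_connection (g : riemannian_metric) (D : connection) :=
  forall X Y Z, X (g Y Z) = g (D X Y) Z + g Y (D X Z).

Definition torsion (D : connection) X Y : V := D X Y - D Y X - lie X Y.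

Definition torsion3 (g : riemannian_metric) (D : connection) :
    V -> V -> V -> A :=
  fun X Y Z => g (torsion D X Y) Z.

Definition has_skew_torsion (g : riemannian_metric) (D : connection) :=
  is_3form (torsion3 g D).

Definition cov_endo (D : connection) (h : V -> V) : V -> V -> V :=
  fun X Y => D X (h Y) - h (D X Y).

Definition cov3 (D : connection) (a : V -> V -> V -> A) :
    V -> V -> V -> V -> A :=
  fun X Y Z W =>
    X (a Y Z W) - a (D X Y) Z W - a Y (D X Z) W - a Y Z (D X W).

End tensors.

(** * Almost 3-contact metric structures *)

Section almost_3contact.
Context (R : realType) (d : nat) (M : manifold R d).
Local Notation A := (smooth_fun M).
Local Notation V := (vfield M).
Implicit Types X Y Z : V.

Record is_almost_contact_metric (phi : V -> V) (xi : V) (eta : V -> A)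
    (g : riemannian_metric M) : Prop := IsAlmostContactMetric {
  acm_phi2 : forall X, phi (phi X) = - X + eta X *: xi;
  acm_eta_xi : eta xi = 1;
  acm_compat : forall X Y, g (phi X) (phi Y) = g X Y - eta X * eta Y }.

(* The indices 1, 2, 3 are 0, 1, 2 : 'I_3, with addition modulo 3. The even
   permutations (i, j, k) of (1, 2, 3) are exactly the cyclic ones, i.e. the
   (i, i + 1, i + 2) for i : 'I_3. *)
Record almost_3contact_metric := Almost3ContactMetric {
  phi : 'I_3 -> {linear V -> V};
  xi : 'I_3 -> V;
  eta : 'I_3 -> {scalar V};
  a3c_metric : riemannian_metric M;
  a3c_acm : forall i,
    is_almost_contact_metric (phi i) (xi i) (eta i) a3c_metric;
  a3c_phi : forall (i : 'I_3) (j := i + 1) (k := i + 2) X,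
    phi k X = phi i (phi j X) - eta j X *: xi i;
  a3c_phiN : forall (i : 'I_3) (j := i + 1) (k := i + 2) X,
    phi k X = - phi j (phi i X) + eta i X *: xi j;
  a3c_xi : forall (i : 'I_3) (j := i + 1) (k := i + 2), xi k = phi i (xi j);
  a3c_xiN : forall (i : 'I_3) (j := i + 1) (k := i + 2), xi k = - phi j (xi i);
  a3c_eta : forall (i : 'I_3) (j := i + 1) (k := i + 2) X,
    eta k X = eta i (phi j X);
  a3c_etaN : forall (i : 'I_3) (j := i + 1) (k := i + 2) X,
    eta k X = - eta j (phi i X) }.

Variable S : almost_3contact_metric.
Local Notation g := (a3c_metric S).
Implicit Type i : 'I_3.

Definition Phi i : V -> V -> A := fun X Y => g X (phi S i Y).

(* [eta_jk i] is eta_j /\ eta_k for the even permutation (i, j, k). *)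
Definition eta_jk i : V -> V -> A := wedge11 (eta S (i + 1)) (eta S (i + 2)).

Definition PhiH i : V -> V -> A := Phi i + eta_jk i.

Definition eta123 : V -> V -> V -> A :=
  wedge12 (eta S 0) (wedge11 (eta S 1) (eta S 2)).

Definition is_3ad_sasaki (alpha delta : R) : Prop :=
  alpha != 0 /\
  forall i, ext1 (eta S i) =
    (2 * alpha) *: Phi i + (2 * (alpha - delta)) *: eta_jk i.

(* These conditions determine D. *)
Record is_canonical_connection (alpha delta : R) (D : connection M) : Prop :=
  IsCanonicalConnection {
  canonical_metric : is_metric_connection g D;
  canonical_skew : has_skew_torsion g D;
  canonical_phi : forall (i : 'I_3) (j := i + 1) (k := i + 2)
      (beta := 2 * (delta - 2 * alpha)) X Y,
    cov_endo D (phi S i) X Y =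
      (beta *: eta S k X) *: phi S j Y - (beta *: eta S j X) *: phi S k Y }.

End almost_3contact.

(* Main.v *)
(** The canonical connection rotates the frames:
    nabla_X xi_i = beta (eta_k(X) xi_j - eta_j(X) xi_k), and similarly for
    eta_i and Phi_i.  Comparing d eta_i with the derivatives of eta_i gives
    T(X, Y, xi_i) = d eta_i (X, Y) + 2 beta eta_jk (X, Y).  On horizontal
    vectors nabla phi_i = 0, so d (d eta_i) = 0 says that phi_i, acting as a derivation,
    annihilates the horizontal part of T; a 3-form killed by a complex structure
    in this way vanishes.  Hence T is determined.  It is an invariant polynomial
    in the rotated triples (eta_i) and (Phi_i), so nabla T = 0, and dT comes from
    d (eta_i /\ d eta_i) = d eta_i /\ d eta_i. *)
From HB Require Import structures.
Require Import Defs.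
From mathcomp Require Import all_boot all_order all_algebra.
From mathcomp Require Import all_classical all_reals all_analysis.
From mathcomp Require Import ring lra.
Set Implicit Arguments.
Unset Strict Implicit.
Unset Printing Implicit Defensive.
Import Order.TTheory GRing.Theory Num.Theory.
Local Open Scope ring_scope.

(** * Smooth functions, constants, derivations and the Lie bracket *)

Section SmoothFunctions.
Context (R : realType) (d : nat) (M : manifold R d).
Local Notation A := (smooth_fun M).
Local Notation V := (vfield M).
Implicit Types (f g h : A) (X Y Z W : V).

Lemma smooth_eq f g : (forall p, f p = g p) -> f = g.
Proof. by move=> fg; apply/val_inj/funext. Qed.

Lemma smooth_addE f g p : (f + g) p = f p + g p. Proof. by []. Qed.
Lemma smooth_oppE f p : (- f) p = - f p. Proof. by []. Qed.
Lemma smooth_mulE f g p : (f * g) p = f p * g p. Proof. by []. Qed.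
Lemma smooth_scaleE (a : R) f p : (a *: f) p = a * f p. Proof. by []. Qed.
Lemma smooth_0E p : (0 : A) p = 0. Proof. by []. Qed.
Lemma smooth_1E p : (1 : A) p = 1. Proof. by []. Qed.
Definition smoothE :=
  (smooth_addE, smooth_oppE, smooth_mulE, smooth_scaleE, smooth_0E, smooth_1E).

(** Real scalars as elements of the ring of functions; being a ring morphism, it lets [ring] compute
    with the coefficients in [alpha] and [delta]. *)
Definition smooth_cst (r : R) : A := r *: (1 : A).

Lemma smooth_cst_is_zmod_morphism : zmod_morphism smooth_cst.
Proof. by move=> r s; rewrite /smooth_cst scalerBl. Qed.

Lemma smooth_cst_is_monoid_morphism : monoid_morphism smooth_cst.
Proof.
split=> [|r s]; first exact: scale1r.
by apply: smooth_eq => p; rewrite !smoothE !mulr1.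
Qed.

HB.instance Definition _ :=
  GRing.isZmodMorphism.Build R A smooth_cst smooth_cst_is_zmod_morphism.
HB.instance Definition _ :=
  GRing.isMonoidMorphism.Build R A smooth_cst smooth_cst_is_monoid_morphism.

Lemma smooth_scale_cst (r : R) (f : A) : r *: f = smooth_cst r * f.
Proof. by apply: smooth_eq => p; rewrite !smoothE mulr1. Qed.

(** Smooth functions need not form a domain, but they have no nilpotents, since their values lie in
    a field. *)
Lemma smooth_sqr_eq0 f : f * f = 0 -> f = 0.
Proof.
move=> f20; apply: smooth_eq => p.
have : (f * f) p = 0 by rewrite f20.
by move/eqP; rewrite smooth_mulE mulf_eq0 orbb => /eqP.
Qed.

Lemma vfieldD X f g : X (f + g) = (X f : A) + X g.
Proof. by have /derivationP[] := vfield_valP X. Qed.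

Lemma vfieldZ X (a : R) f : X (a *: f) = a *: (X f : A).
Proof. by have /derivationP[] := vfield_valP X. Qed.

Lemma vfieldM X f g : X (f * g) = f * X g + g * X f.
Proof. by have /derivationP[] := vfield_valP X. Qed.

Lemma vfieldN X f : X (- f) = - (X f : A).
Proof. by rewrite -scaleN1r vfieldZ scaleN1r. Qed.

Lemma vfieldB X f g : X (f - g) = (X f : A) - X g.
Proof. by rewrite vfieldD vfieldN. Qed.

Lemma vfield1 X : X (1 : A) = 0 :> A.
Proof.
have := vfieldM X 1 1; rewrite !mul1r => /eqP.
by rewrite -subr_eq subrr eq_sym => /eqP.
Qed.

Lemma lieE X Y f : lie X Y f = (X (Y f) : A) - Y (X f). Proof. by []. Qed.

Lemma vfield_addE X Y f : (X + Y) f = (X f : A) + Y f. Proof. by []. Qed.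
Lemma vfield_oppE X f : (- X) f = - (X f : A). Proof. by []. Qed.
Lemma vfield_eq X Y : (forall f, X f = Y f :> A) -> X = Y.
Proof. by move=> XY; apply/val_inj/funext. Qed.

Lemma lieN X Y : lie Y X = - lie X Y.
Proof. by apply: vfield_eq => f; rewrite vfield_oppE !lieE opprB. Qed.

Lemma lie_jacobi X Y Z :
  lie (lie X Y) Z - lie (lie X Z) Y + lie (lie Y Z) X = 0.
Proof.
apply: vfield_eq => f; rewrite !vfield_addE vfield_oppE !lieE !vfieldB.
rewrite [RHS](_ : _ = 0 :> A) //; ring.
Qed.

End SmoothFunctions.

(** * Exterior derivatives in low degree: [d d = 0] and Leibniz rules *)

Section ExteriorCalculus.
Context (R : realType) (d : nat) (M : manifold R d).
Local Notation A := (smooth_fun M).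
Local Notation V := (vfield M).
Implicit Types (X Y Z W : V) (a b c : {scalar V}) (w : V -> V -> A).

Definition ext2 w : V -> V -> V -> A := fun X Y Z =>
  X (w Y Z) - Y (w X Z) + Z (w X Y)
  - w (lie X Y) Z + w (lie X Z) Y - w (lie Y Z) X.

Lemma ext1_skew a X Y : ext1 a X Y = - ext1 a Y X.
Proof. rewrite /ext1 (lieN X Y) linearN /=; ring. Qed.

Lemma ext2_ext1 a : ext2 (ext1 a) = 0.
Proof.
apply/funext => X; apply/funext => Y; apply/funext => Z.
rewrite [RHS](_ : _ = 0 :> A) //.
have := congr1 a (lie_jacobi X Y Z); rewrite linear0 linearD linearB /= => J.
rewrite /ext2 /ext1 !lieE !vfieldB.
(* The zero on the right becomes the image under [a] of the Jacobi sum, which matches the double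
   brackets on the left. *)
rewrite -J; ring.
Qed.

(** Leibniz rule d(a /\ w) = da /\ w - a /\ dw; the parenthesis is the wedge a /\ dw of bidegree (1,
    3), written out. *)
Lemma ext3_wedge12 a w X Y Z W : (forall P Q, w P Q = - w Q P) ->
  ext3 (wedge12 a w) X Y Z W = wedge22 (ext1 a) w X Y Z W
    - (a X * ext2 w Y Z W - a Y * ext2 w X Z W
       + a Z * ext2 w X Y W - a W * ext2 w X Y Z).
Proof.
move=> skw; rewrite /ext3 /wedge12 /wedge22 /ext1 /ext2 !vfieldD !vfieldM.
(* [wedge12] permutes its arguments cyclically; skewness brings all values of [w] to one order of
   arguments, brackets first. *)
rewrite (skw W Y) (skw Z X) (skw W X) !vfieldN.
rewrite !(skw _ (lie _ _)); ring.
Qed.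

Lemma ext2_wedge11 b c :
  ext2 (wedge11 b c) = wedge12 c (ext1 b) - wedge12 b (ext1 c).
Proof.
apply/funext => X; apply/funext => Y; apply/funext => Z.
rewrite [RHS](_ : _ = wedge12 c (ext1 b) X Y Z - wedge12 b (ext1 c) X Y Z) //.
rewrite /ext2 /wedge11 /wedge12 !(ext1_skew _ Z X) /ext1 !vfieldB !vfieldM.
ring.
Qed.

Lemma ext3_wedge12_ext1 a b :
  ext3 (wedge12 a (ext1 b)) = wedge22 (ext1 a) (ext1 b).
Proof.
apply/funext => X; apply/funext => Y; apply/funext => Z; apply/funext => W.
rewrite ext3_wedge12; last exact: ext1_skew.
by rewrite ext2_ext1 /= !mulr0 !subr0 addr0 subr0.
Qed.

(** In the Leibniz rule, d(b /\ c) = c /\ db - b /\ dc; commuting 1-forms past the 2-forms db and dc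
    turns the signs into the cyclic sum. *)
Lemma ext3_wedge111 a b c : ext3 (wedge12 a (wedge11 b c)) =
  wedge22 (ext1 a) (wedge11 b c) + wedge22 (ext1 b) (wedge11 c a)
  + wedge22 (ext1 c) (wedge11 a b).
Proof.
apply/funext => X; apply/funext => Y; apply/funext => Z; apply/funext => W.
rewrite ext3_wedge12; last by move=> P Q; rewrite /wedge11; ring.
rewrite ext2_wedge11.
rewrite [RHS](_ : _ = wedge22 (ext1 a) (wedge11 b c) X Y Z W
  + wedge22 (ext1 b) (wedge11 c a) X Y Z W
  + wedge22 (ext1 c) (wedge11 a b) X Y Z W) //.
have E P Q N : (wedge12 c (ext1 b) - wedge12 b (ext1 c)) P Q N
  = wedge12 c (ext1 b) P Q N - wedge12 b (ext1 c) P Q N by [].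
rewrite !E -!addrA; congr (_ + _); rewrite /wedge12 /wedge22 /wedge11.
rewrite !(ext1_skew _ W Y) !(ext1_skew _ W X) !(ext1_skew _ Z X); ring.
Qed.

Lemma ext3D (u v : V -> V -> V -> A) : ext3 (u + v) = ext3 u + ext3 v.
Proof.
apply/funext => X; apply/funext => Y; apply/funext => Z; apply/funext => W.
rewrite [RHS](_ : _ = ext3 u X Y Z W + ext3 v X Y Z W) //.
have E P Q N : (u + v) P Q N = u P Q N + v P Q N by [].
rewrite /ext3 !E !vfieldD; ring.
Qed.

Lemma ext3Z (r : R) (u : V -> V -> V -> A) : ext3 (r *: u) = r *: ext3 u.
Proof.
apply/funext => X; apply/funext => Y; apply/funext => Z; apply/funext => W.
rewrite [RHS](_ : _ = r *: ext3 u X Y Z W) //.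
have E P Q N : (r *: u) P Q N = r *: u P Q N by [].
by rewrite /ext3 !E !vfieldZ !(scalerBr, scalerDr).
Qed.

End ExteriorCalculus.

(** * The metric and a single almost contact metric structure *)

Section Metric.
Context (R : realType) (d : nat) (M : manifold R d) (g : riemannian_metric M).
Local Notation A := (smooth_fun M).
Local Notation V := (vfield M).
Implicit Types (X Y Z : V) (f : A).

Lemma metricDr X Y Z : g X (Y + Z) = g X Y + g X Z.
Proof. by have := metric_linear g X 1 Y Z; rewrite scale1r mul1r. Qed.

Lemma metric0r X : g X 0 = 0.
Proof. by apply: (addIr (g X 0)); rewrite -metricDr !add0r. Qed.

Lemma metricZr X f Y : g X (f *: Y) = f * g X Y.
Proof. by have := metric_linear g X f Y 0; rewrite metric0r !addr0. Qed.

Lemma metricNr X Y : g X (- Y) = - g X Y.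
Proof. by rewrite -scaleN1r metricZr mulN1r. Qed.

Lemma metricC X Y : g X Y = g Y X.
Proof. exact: Defs.metric_sym. Qed.

Lemma metricDl X Y Z : g (X + Y) Z = g X Z + g Y Z.
Proof. by rewrite !(metricC _ Z) metricDr. Qed.

Lemma metricNl X Y : g (- X) Y = - g X Y.
Proof. by rewrite !(metricC _ Y) metricNr. Qed.

Section AlmostContactMetric.
Context (ph : {linear V -> V}) (xi : V) (eta : {scalar V}).
Hypothesis acm : is_almost_contact_metric ph xi eta g.

(** From ph^2 xi = 0 follows 0 = ph^2 (ph xi) = - ph xi + c xi with c = eta (ph xi). Hence ph xi = c
    xi, so c^2 xi = 0, and applying [eta] gives c^2 = 0. *)
Lemma acm_phi_xi : ph xi = 0.
Proof.
have ph2 := acm_phi2 acm; have exi := acm_eta_xi acm.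
have p2 : ph (ph xi) = 0 by rewrite ph2 exi scale1r addNr.
have p3 := ph2 (ph xi).
rewrite p2 linear0 in p3; move/esym/eqP: p3.
rewrite addrC subr_eq0 => /eqP cE.
move: p2 cE; set c := eta _ => p2 cE.
move: p2; rewrite -cE linearZ /= -cE scalerA => /(congr1 eta).
by rewrite linearZ /= exi mulr1 linear0 => /smooth_sqr_eq0 ->; rewrite scale0r.
Qed.

(** Compare the two readings of ph^3 X, as ph^2 (ph X) and as ph (ph^2 X). *)
Lemma acm_eta_phi X : eta (ph X) = 0.
Proof.
have := acm_phi2 acm (ph X).
rewrite (acm_phi2 acm X) linearD linearN linearZ /=.
rewrite acm_phi_xi scaler0 addr0 -[LHS]addr0 => /addrI /(congr1 eta).
by rewrite linearZ /= linear0 (acm_eta_xi acm) mulr1 => <-.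
Qed.

Lemma acm_metric_xi X : g X xi = eta X.
Proof.
have := acm_compat acm X xi.
rewrite acm_phi_xi metric0r (acm_eta_xi acm) mulr1 => /esym/eqP.
by rewrite subr_eq0 => /eqP.
Qed.

Lemma acm_metric_phi X Y : g X (ph Y) = - g (ph X) Y.
Proof.
have := acm_compat acm X (ph Y); rewrite (acm_phi2 acm) acm_eta_phi mulr0 subr0.
move=> <-; rewrite metricDr metricNr metricZr acm_metric_xi acm_eta_phi.
by rewrite mulr0 addr0.
Qed.

End AlmostContactMetric.
End Metric.

(** * Cyclic indices and the action of the three structures on the Reeb fields *)

Lemma ord3_addA (i : 'I_3) :
  [/\ i + 1 + 1 = i + 2, i + 1 + 2 = i, i + 2 + 1 = i & i + 2 + 2 = i + 1].
Proof. by case: i => -[|[|[|//]]] lti; split; exact/val_inj. Qed.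

Lemma sum_ord3 (U : zmodType) (F : 'I_3 -> U) :
  \sum_(i < 3) F i = F 0 + F 1 + F 2.
Proof.
rewrite !big_ord_recl big_ord0 addr0 addrA.
by congr (F _ + F _ + F _); exact/val_inj.
Qed.

Section Almost3Contact.
Context (R : realType) (d : nat) (M : manifold R d).
Local Notation A := (smooth_fun M).
Local Notation V := (vfield M).
Implicit Types (X Y Z : V) (f : A) (i : 'I_3).
Variable S : almost_3contact_metric M.
Local Notation g := (a3c_metric S).
Local Notation phi := (phi S).
Local Notation xi := (xi S).
Local Notation eta := (eta S).

Lemma phi_xi i : phi i (xi i) = 0.
Proof. exact: acm_phi_xi (a3c_acm S i). Qed.

Lemma phi_xi1 i : phi i (xi (i + 1)) = xi (i + 2).
Proof. by rewrite a3c_xi. Qed.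

Lemma phi_xi2 i : phi i (xi (i + 2)) = - xi (i + 1).
Proof.
have [_ _ e _] := ord3_addA i; have [_ _ _ e'] := ord3_addA i.
by have := a3c_xiN S (i + 2); rewrite /= e e' => ->; rewrite opprK.
Qed.

Lemma eta_xi i : eta i (xi i) = 1.
Proof. exact: acm_eta_xi (a3c_acm S i). Qed.

Lemma eta_phi i X : eta i (phi i X) = 0.
Proof. exact: acm_eta_phi (a3c_acm S i) X. Qed.

Lemma eta_xi1 i : eta i (xi (i + 1)) = 0.
Proof. by rewrite -[xi _]opprK -phi_xi2 linearN /= eta_phi oppr0. Qed.

Lemma eta_xi2 i : eta i (xi (i + 2)) = 0.
Proof. by rewrite -phi_xi1 eta_phi. Qed.

Lemma eta1_xi i : eta (i + 1) (xi i) = 0.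
Proof. by have := eta_xi2 (i + 1); have [_ -> _ _] := ord3_addA i. Qed.

Lemma eta2_xi i : eta (i + 2) (xi i) = 0.
Proof. by have := eta_xi1 (i + 2); have [_ _ -> _] := ord3_addA i. Qed.

Lemma metric_xi i X : g X (xi i) = eta i X.
Proof. exact: acm_metric_xi (a3c_acm S i) X. Qed.

Lemma metric_xil i X : g (xi i) X = eta i X.
Proof. by rewrite metricC metric_xi. Qed.

Lemma Phi_skew i X Y : Phi S i X Y = - Phi S i Y X.
Proof. by rewrite /Phi (acm_metric_phi (a3c_acm S i)) metricC. Qed.

Lemma Phi_xi i X : Phi S i X (xi i) = 0.
Proof. by rewrite /Phi phi_xi metric0r. Qed.

Lemma Phi_xi1 i X : Phi S i X (xi (i + 1)) = eta (i + 2) X.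
Proof. by rewrite /Phi phi_xi1 metric_xi. Qed.

Lemma Phi_xi2 i X : Phi S i X (xi (i + 2)) = - eta (i + 1) X.
Proof. by rewrite /Phi phi_xi2 metricNr metric_xi. Qed.

End Almost3Contact.

(** * Algebra of 3-forms and complex structures *)

Section ThreeForms.
Context (R : realType) (d : nat) (M : manifold R d).
Local Notation A := (smooth_fun M).
Local Notation V := (vfield M).
Implicit Types (X Y Z : V) (f : A).
Context (a : V -> V -> V -> A) (a3 : is_3form a).

Lemma form3D1 X X' Y Z : a (X + X') Y Z = a X Y Z + a X' Y Z.
Proof.
by have /= := form3_linear1 a3 Y Z 1 X X'; rewrite scale1r mul1r.
Qed.

Lemma form3D2 X Y Y' Z : a X (Y + Y') Z = a X Y Z + a X Y' Z.
Proof.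
by have /= := form3_linear2 a3 X Z 1 Y Y'; rewrite scale1r mul1r.
Qed.

Lemma form3D3 X Y Z Z' : a X Y (Z + Z') = a X Y Z + a X Y Z'.
Proof.
by have /= := form3_linear3 a3 X Y 1 Z Z'; rewrite scale1r mul1r.
Qed.

Lemma form3_skew12 X Y Z : a Y X Z = - a X Y Z.
Proof.
have := form3_alt12 a3 (X + Y) Z; rewrite form3D1 !form3D2 !(form3_alt12 a3).
by rewrite add0r addr0 => /eqP; rewrite addrC addr_eq0 => /eqP.
Qed.

Lemma form3_skew23 X Y Z : a X Z Y = - a X Y Z.
Proof.
have := form3_alt23 a3 X (Y + Z); rewrite form3D2 !form3D3 !(form3_alt23 a3).
by rewrite add0r addr0 => /eqP; rewrite addrC addr_eq0 => /eqP.
Qed.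

Lemma form3_rot X Y Z : a Y Z X = a X Y Z.
Proof. by rewrite form3_skew23 form3_skew12 opprK. Qed.

Lemma form3N1 X Y Z : a (- X) Y Z = - a X Y Z.
Proof.
have a0 : a 0 Y Z = 0.
  by apply: (addIr (a 0 Y Z)); rewrite -form3D1 !add0r.
have /= := form3_linear1 a3 Y Z (- 1) X 0.
by rewrite !addr0 a0 scaleN1r addr0 mulN1r.
Qed.

Lemma form3N2 X Y Z : a X (- Y) Z = - a X Y Z.
Proof. by rewrite form3_skew12 form3N1 -form3_skew12. Qed.

Lemma form3N3 X Y Z : a X Y (- Z) = - a X Y Z.
Proof. by rewrite form3_skew23 form3N2 -form3_skew23. Qed.

(* J acts on the (p, q)-part of a by i (p - q), and p - q is odd since
   p + q = 3. *)
Lemma form3_complex_eq0 (P : V -> Prop) (J : V -> V) :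
    (forall X, P X -> P (J X)) -> (forall X, P X -> J (J X) = - X) ->
    (forall X Y Z, P X -> P Y -> P Z ->
       a (J X) Y Z + a X (J Y) Z + a X Y (J Z) = 0) ->
  forall X Y Z, P X -> P Y -> P Z -> a X Y Z = 0.
Proof.
move=> PJ JJ aJ X Y Z PX PY PZ; apply: smooth_eq => p.
have [PJX PJY PJZ] := And3 (PJ _ PX) (PJ _ PY) (PJ _ PZ).
have := congr1 (fun f : A => f p) (aJ _ _ _ PJX PY PZ).
have := congr1 (fun f : A => f p) (aJ _ _ _ PX PJY PZ).
have := congr1 (fun f : A => f p) (aJ _ _ _ PX PY PJZ).
have := congr1 (fun f : A => f p) (aJ _ _ _ PJX PJY PJZ).
rewrite !JJ // !form3N1 !form3N2 !form3N3 !smoothE.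
(* Let s be the sum of the three values of [a] with [J] on two arguments. The identities with one
   [J] added to the arguments sum to 2 s = 3 a(X, Y, Z); the one with three gives s = 0. *)
lra.
Qed.

End ThreeForms.

(** * Horizontal projection and the horizontal fundamental forms *)

Lemma ord3_cases (i l : 'I_3) : [\/ l = i, l = i + 1 | l = i + 2].
Proof.
case: i l => -[|[|[|//]]] lti [[|[|[|//]]] ltl];
  first [by constructor 1; apply: val_inj|by constructor 2; apply: val_inj
        |by constructor 3; apply: val_inj].
Qed.

Lemma ord3E : ((0 : 'I_3) + 1 = 1) * ((0 : 'I_3) + 2 = 2)
  * ((1 : 'I_3) + 1 = 2) * ((1 : 'I_3) + 2 = 0)
  * ((2 : 'I_3) + 1 = 0) * ((2 : 'I_3) + 2 = 1).
Proof. by do !split; exact/val_inj. Qed.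

Section HorizontalPart.
Context (R : realType) (d : nat) (M : manifold R d).
Local Notation A := (smooth_fun M).
Local Notation V := (vfield M).
Implicit Types (X Y Z : V) (f : A) (i : 'I_3).
Variable S : almost_3contact_metric M.
Local Notation g := (a3c_metric S).
Local Notation phi := (phi S).
Local Notation xi := (xi S).
Local Notation eta := (eta S).

Definition horizontal X := forall i, eta i X = 0.

(** The projection X - sum_i eta_i(X) xi_i, nested in the shape [a *: u + v] so that a [scalar]
    hypothesis expands it directly. *)
Definition hor X : V := (- eta 0 X) *: xi 0 +
  ((- eta 1 X) *: xi 1 + ((- eta 2 X) *: xi 2 + X)).

Lemma hor_decomp (L : V -> A) X : scalar L ->
  L X = L (hor X) + (eta 0 X * L (xi 0) + eta 1 X * L (xi 1)
                     + eta 2 X * L (xi 2)).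
Proof. move=> Ll; rewrite /hor !Ll; ring. Qed.

Lemma eta_xiE i j : eta i (xi j) = (i == j)%:R.
Proof.
have [->|->|->] := ord3_cases i j.
- by rewrite eta_xi eqxx.
- by rewrite eta_xi1; case: i => -[|[|[|//]]] lti.
- by rewrite eta_xi2; case: i => -[|[|[|//]]] lti.
Qed.

Lemma hor_horizontal X : horizontal (hor X).
Proof.
move=> i; rewrite /hor !(linearD, linearZ) /= !eta_xiE.
by have [->|->|->] := ord3_cases 0 i => /=; rewrite ?ord3E /=; ring.
Qed.

(** Composition with [phi 0] exchanges [eta 1] and [eta 2] up to sign, so [phi 0] can serve as a
    complex structure on horizontal fields. *)
Lemma horizontal_phi0 X : horizontal X -> horizontal (phi 0 X).
Proof.
move=> hX i; have [->|->|->] := ord3_cases 0 i.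
- exact: eta_phi.
- have := a3c_etaN S 0 X; rewrite /= hX => /esym/eqP.
  by rewrite oppr_eq0 => /eqP.
- by have := a3c_eta S 2 X; rewrite /= hX !ord3E => /esym.
Qed.

Lemma PhiHE i X Y :
  PhiH S i X Y = Phi S i X Y + eta_jk S i X Y. Proof. by []. Qed.

Lemma PhiH_linear i X : scalar (PhiH S i X).
Proof.
move=> f Y Z; rewrite !PhiHE /Phi /eta_jk /wedge11 !linearP /=.
by rewrite metricDr metricZr; ring.
Qed.

Lemma PhiH_skew i X Y : PhiH S i X Y = - PhiH S i Y X.
Proof. rewrite !PhiHE Phi_skew /eta_jk /wedge11; ring. Qed.

(** On the second and third Reeb fields of the triple, Phi_i gives eta_k(X) and - eta_j(X), which
    eta_jk cancels. *)
Lemma PhiH_xi i j X : PhiH S i X (xi j) = 0.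
Proof.
rewrite PhiHE /eta_jk /wedge11.
have [->|->|->] := ord3_cases i j.
- by rewrite Phi_xi eta1_xi eta2_xi; ring.
- have := eta1_xi S (i + 1); have [-> _ _ _] := ord3_addA i => e.
  by rewrite Phi_xi1 eta_xi e; ring.
- have := eta2_xi S (i + 2); have [_ _ _ ->] := ord3_addA i => e.
  by rewrite Phi_xi2 eta_xi e; ring.
Qed.

Lemma PhiH_hor i X Y : PhiH S i X (hor Y) = PhiH S i X Y.
Proof.
by rewrite [RHS](hor_decomp _ (PhiH_linear i X)) !PhiH_xi !mulr0 !addr0.
Qed.

End HorizontalPart.

Lemma lincomb_sum_ord3E (R : realType) (d : nat) (M : manifold R d)
    (V := vfield M) (A := smooth_fun M) (r s : R)
    (u v : 'I_3 -> V -> V -> V -> V -> A) (X Y Z W : V) :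
  (r *: (\sum_(i < 3) u i) + s *: (\sum_(i < 3) v i)) X Y Z W =
  r *: (u 0 X Y Z W + u 1 X Y Z W + u 2 X Y Z W)
  + s *: (v 0 X Y Z W + v 1 X Y Z W + v 2 X Y Z W).
Proof. by rewrite !sum_ord3. Qed.

(** * The canonical connection, its torsion, and the derivatives of the torsion *)

Section CanonicalConnection.
Context (R : realType) (d : nat) (M : manifold R d).
Local Notation A := (smooth_fun M).
Local Notation V := (vfield M).
Implicit Types (X Y Z W : V) (f : A) (i : 'I_3).
Variables (S : almost_3contact_metric M) (alpha delta : R) (D : connection M).
Hypothesis hS : is_3ad_sasaki S alpha delta.
Hypothesis hD : is_canonical_connection S alpha delta D.
Local Notation g := (a3c_metric S).
Local Notation phi := (phi S).
Local Notation xi := (xi S).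
Local Notation eta := (eta S).
Local Notation beta := (2 * (delta - 2 * alpha)).
Local Notation T := (torsion3 g D).

Lemma sasaki_ext1 i X Y : ext1 (eta i) X Y =
  (2 * alpha) *: Phi S i X Y + (2 * (alpha - delta)) *: eta_jk S i X Y.
Proof. by have [_ ->] := hS. Qed.

Lemma nabla_phi i X Y : D X (phi i Y) = phi i (D X Y)
  + ((beta *: eta (i + 2) X) *: phi (i + 1) Y
     - (beta *: eta (i + 1) X) *: phi (i + 2) Y).
Proof. by have /= <- := canonical_phi hD i X Y; rewrite addrC subrK. Qed.

(** Differentiating phi_i xi_i = 0 gives phi_i (nabla_X xi_i). A second phi_i recovers nabla_X xi_i,
    because xi_i has unit length and so nabla_X xi_i has no xi_i component. *)
Lemma nabla_xi i X : D X (xi i) =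
  (beta *: eta (i + 2) X) *: xi (i + 1) - (beta *: eta (i + 1) X) *: xi (i + 2).
Proof.
have D0 : D X 0 = 0 by apply: (addIr (D X 0)); rewrite -nablaD !add0r.
have eD : eta i (D X (xi i)) = 0.
  have := canonical_metric hD X (xi i) (xi i).
  rewrite metric_xi eta_xi vfield1 metric_xi metric_xil => /esym e.
  apply: smooth_eq => p; have := congr1 (fun f : A => f p) e.
  by rewrite !smoothE; lra.
have pj : phi (i + 1) (xi i) = - xi (i + 2).
  by have := phi_xi2 S (i + 1); have [-> -> _ _] := ord3_addA i.
have pk : phi (i + 2) (xi i) = xi (i + 1).
  by have := phi_xi1 S (i + 2); have [_ _ -> ->] := ord3_addA i.
have := nabla_phi i X (xi i); rewrite phi_xi D0 pj pk.
set b := beta; move=> /esym/eqP.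
rewrite addr_eq0 => /eqP /(congr1 (phi i)).
rewrite (acm_phi2 (a3c_acm S i)) eD scale0r addr0.
rewrite linearN linearB !linearZ /= linearN /= phi_xi1 phi_xi2 !scalerN.
by move/oppr_inj => ->; rewrite opprK addrC.
Qed.

(** Metric compatibility applied to g(Y, xi_i); the bracketed terms are (nabla_X eta_i)(Y). *)
Lemma vfield_eta i X Y : X (eta i Y) = eta i (D X Y) +
  (beta *: eta (i + 2) X * eta (i + 1) Y
   - beta *: eta (i + 1) X * eta (i + 2) Y) :> A.
Proof.
rewrite -!(metric_xi S i) (canonical_metric hD) nabla_xi; congr (_ + _).
by rewrite metricDr metricNr !metricZr !metric_xi.
Qed.

Lemma vfield_Phi i X Y Z :
  X (Phi S i Y Z) = Phi S i (D X Y) Z + Phi S i Y (D X Z) +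
    (beta *: eta (i + 2) X * Phi S (i + 1) Y Z
     - beta *: eta (i + 1) X * Phi S (i + 2) Y Z) :> A.
Proof.
rewrite /Phi (canonical_metric hD) nabla_phi -!addrA; congr (_ + _).
by rewrite !metricDr metricNr !metricZr.
Qed.

Lemma torsion3_xi i X Y : T X Y (xi i) =
  (2 * alpha) *: PhiH S i X Y + (2 * (delta - 4 * alpha)) *: eta_jk S i X Y.
Proof.
have ext1T : ext1 (eta i) X Y = T X Y (xi i) - (2 * beta) *: eta_jk S i X Y.
  rewrite /torsion3 /torsion metric_xi !linearB /= /ext1 !vfield_eta.
  by rewrite /eta_jk /wedge11 !smooth_scale_cst; ring.
have := sasaki_ext1 i X Y; rewrite ext1T => /eqP.
(* The coefficient of eta_jk is 2 (alpha - delta) + 2 beta - 2 alpha = 2 (delta - 4 alpha), where -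
   2 alpha comes from passing from Phi_i to its horizontal part. *)
rewrite subr_eq => /eqP ->; rewrite PhiHE.
by rewrite !smooth_scale_cst; ring.
Qed.

(* The cyclic sum is, up to the factor 2 alpha, the value of d (d eta_i) at
   horizontal vectors, along which phi_i is parallel. *)
Lemma torsion3_phi_cycle i X Y Z :
  horizontal S X -> horizontal S Y -> horizontal S Z ->
  T (phi i X) Y Z + T X (phi i Y) Z + T X Y (phi i Z) = 0.
Proof.
move=> hX hY hZ; have T3 := canonical_skew hD.
have dd : ext2 (ext1 (eta i)) X Y Z = 0 by rewrite ext2_ext1.
have jkr U W : horizontal S W -> eta_jk S i U W = 0.
  by move=> hW; rewrite /eta_jk /wedge11 !hW; ring.
(* [U] is arbitrary because [ext2] places the brackets, which may have vertical parts, in the first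
   slot. *)
have dP U W : horizontal S W -> ext1 (eta i) U W = (2 * alpha) *: Phi S i U W.
  by move=> hW; rewrite sasaki_ext1 jkr // scaler0 addr0.
have [a0 _] := hS.
have a20 : 2 * alpha != 0 by rewrite mulf_neq0 ?pnatr_eq0.
have dE : ext2 (ext1 (eta i)) X Y Z = (2 * alpha) *: ext2 (Phi S i) X Y Z.
  by rewrite /ext2 !dP // !vfieldZ !(scalerBr, scalerDr).
move: dd; rewrite dE => /eqP; rewrite scaler_eq0 (negPf a20) /= => /eqP <-.
rewrite /ext2.
rewrite !vfield_Phi !hX !hY !hZ.
(* With phi_i in the last slot, T(X, Y, phi_i Z) is Phi_i(torsion(X, Y), Z); these are the terms of
   d Phi_i once the rotation terms have vanished on horizontal fields. *)
rewrite -(form3_rot T3 (phi i X)) (form3_skew23 T3 X Z) /T /torsion3 /torsion.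
rewrite (Phi_skew S i Y (D X Z)) (Phi_skew S i X (D Y Z)).
rewrite (Phi_skew S i X (D Z Y)).
rewrite /Phi !(metricDl, metricNl) !scaler0; ring.
Qed.

Lemma torsion3_horizontal X Y Z :
  horizontal S X -> horizontal S Y -> horizontal S Z -> T X Y Z = 0.
Proof.
apply: (form3_complex_eq0 (canonical_skew hD) (J := phi 0)).
- exact: horizontal_phi0.
- by move=> {}X hX; rewrite (acm_phi2 (a3c_acm S 0)) hX scale0r addr0.
- exact: torsion3_phi_cycle.
Qed.

Lemma torsion3E X Y Z : T X Y Z =
  (2 * alpha) *: (wedge12 (eta 0) (PhiH S 0) X Y Z
    + wedge12 (eta 1) (PhiH S 1) X Y Z + wedge12 (eta 2) (PhiH S 2) X Y Z)
  + (2 * (delta - 4 * alpha)) *: eta123 S X Y Z.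
Proof.
have T3 := canonical_skew hD.
have hjk i U W : eta_jk S i (hor S U) W = 0.
  by rewrite /eta_jk /wedge11 !(hor_horizontal S U); ring.
have hPhi i U W : PhiH S i (hor S U) W = PhiH S i U W.
  by rewrite PhiH_skew PhiH_hor -PhiH_skew.
have Td P Q W : T P Q W = T P Q (hor S W) + (eta 0 W * T P Q (xi 0)
   + eta 1 W * T P Q (xi 1) + eta 2 W * T P Q (xi 2)).
  exact: (hor_decomp S W (form3_linear3 T3 P Q)).
(* Split the last argument, rotate its horizontal part to the front, and repeat. The three vertical
   parts form the sum of eta_i /\ PhiH_i; eta_jk survives only in the first, where nothing is
   projected yet, and yields [eta123]. *)
rewrite (Td X Y Z) (form3_rot T3 (hor S Z) X Y) (Td _ X Y).
rewrite (form3_rot T3 (hor S Y) _ X) (Td _ _ X).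
rewrite torsion3_horizontal ?add0r; try exact: hor_horizontal.
rewrite !torsion3_xi !hjk !hPhi !PhiH_hor.
rewrite /eta123 /eta_jk /wedge12 /wedge11 !ord3E !smooth_scale_cst; ring.
Qed.

Lemma torsion3_sasaki :
  T = (2 * alpha) *: (\sum_(i < 3) wedge12 (eta i) (PhiH S i))
  + (2 * (delta - 4 * alpha)) *: eta123 S.
Proof.
apply/funext => X; apply/funext => Y; apply/funext => Z.
by rewrite torsion3E sum_ord3.
Qed.

(** Each eta_i /\ eta_jk is [eta123], so the sum contributes 6 (alpha - delta) - 6 alpha = - 6 delta
    to its coefficient in the horizontal formula. *)
Lemma torsion3_ext1 : T = \sum_(i < 3) wedge12 (eta i) (ext1 (eta i))
  + (8 * (delta - alpha)) *: eta123 S.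
Proof.
apply/funext => X; apply/funext => Y; apply/funext => Z.
rewrite torsion3E sum_ord3 [RHS](_ : _ = wedge12 (eta 0) (ext1 (eta 0)) X Y Z
  + wedge12 (eta 1) (ext1 (eta 1)) X Y Z + wedge12 (eta 2) (ext1 (eta 2)) X Y Z
  + (8 * (delta - alpha)) *: eta123 S X Y Z) //.
rewrite /eta123 /wedge12 !sasaki_ext1 !PhiHE /eta_jk /wedge11 !ord3E.
rewrite !smooth_scale_cst; ring.
Qed.

Lemma cov3_torsion3 : cov3 D T = 0.
Proof.
apply/funext => X; apply/funext => Y; apply/funext => Z; apply/funext => W.
rewrite [RHS](_ : _ = 0 :> A) // /cov3 !torsion3E /wedge12 /eta123 /wedge12.
rewrite !PhiHE /eta_jk /wedge11 !ord3E.
(* The terms containing [D] cancel those of [cov3]; the [beta] terms cancel among the three indices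
   by rotation invariance. *)
rewrite !(vfieldZ, vfieldD, vfieldB, vfieldM, vfieldN) !vfield_eta !vfield_Phi.
rewrite !ord3E; rewrite !smooth_scale_cst.
ring.
Qed.

Lemma ext3_eta123 :
  ext3 (eta123 S) = \sum_(i < 3) wedge22 (ext1 (eta i)) (eta_jk S i).
Proof.
rewrite sum_ord3 /eta123 (ext3_wedge111 (eta 0) (eta 1) (eta 2)).
by rewrite /eta_jk !ord3E.
Qed.

Lemma ext3_torsion3 :
  ext3 T = (4 * alpha ^+ 2) *: (\sum_(i < 3) wedge22 (Phi S i) (Phi S i))
    + (8 * alpha * (delta - alpha)) *:
        (\sum_(i < 3) wedge22 (Phi S i) (eta_jk S i)).
Proof.
have -> : ext3 T = 1 *: (\sum_(i < 3) wedge22 (ext1 (eta i)) (ext1 (eta i)))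
    + (8 * (delta - alpha)) *:
        (\sum_(i < 3) wedge22 (ext1 (eta i)) (eta_jk S i)).
  rewrite torsion3_ext1 ext3D ext3Z ext3_eta123 scale1r; congr (_ + _).
  by rewrite !sum_ord3 2!ext3D !(ext3_wedge12_ext1 (eta _)).
apply/funext => X; apply/funext => Y; apply/funext => Z; apply/funext => W.
rewrite [LHS]lincomb_sum_ord3E [RHS]lincomb_sum_ord3E.
(* As eta_jk /\ eta_jk = 0, the mixed coefficient is 8 alpha (alpha - delta) from the squares plus
   16 alpha (delta - alpha) from d [eta123]. *)
rewrite /wedge22 !sasaki_ext1 /eta_jk /wedge11 !ord3E !smooth_scale_cst.
ring.
Qed.

(** Substituting Phi_i = PhiH_i - eta_jk in the squares adds - 8 alpha^2 to the mixed
    coefficient. *)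
Lemma ext3_torsion3_hor :
  ext3 T = (4 * alpha ^+ 2) *: (\sum_(i < 3) wedge22 (PhiH S i) (PhiH S i))
    + (8 * alpha * (delta - 2 * alpha)) *:
        (\sum_(i < 3) wedge22 (PhiH S i) (eta_jk S i)).
Proof.
rewrite ext3_torsion3.
apply/funext => X; apply/funext => Y; apply/funext => Z; apply/funext => W.
rewrite [LHS]lincomb_sum_ord3E [RHS]lincomb_sum_ord3E.
rewrite /wedge22 !PhiHE /eta_jk /wedge11 !ord3E !smooth_scale_cst.
ring.
Qed.

End CanonicalConnection.

Theorem theorem4p4p1 (R : realType) (n : nat) (M : manifold R (4 * n + 3))
    (S : almost_3contact_metric M) (alpha delta : R)
    (hS : is_3ad_sasaki S alpha delta)
    (D : connection M) (hD : is_canonical_connection S alpha delta D) :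
  let T := torsion3 (a3c_metric S) D in
  [/\ T = \sum_(i < 3) wedge12 (eta S i) (ext1 (eta S i))
          + (8 * (delta - alpha)) *: eta123 S,
      T = (2 * alpha) *: (\sum_(i < 3) wedge12 (eta S i) (PhiH S i))
          + (2 * (delta - 4 * alpha)) *: eta123 S,
      cov3 D T = 0,
      ext3 T = (4 * alpha ^+ 2) *: (\sum_(i < 3) wedge22 (Phi S i) (Phi S i))
               + (8 * alpha * (delta - alpha)) *:
                   (\sum_(i < 3) wedge22 (Phi S i) (eta_jk S i))
    & ext3 T = (4 * alpha ^+ 2) *:
                   (\sum_(i < 3) wedge22 (PhiH S i) (PhiH S i))
               + (8 * alpha * (delta - 2 * alpha)) *:
                   (\sum_(i < 3) wedge22 (PhiH S i) (eta_jk S i))].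
Proof.
split.
- exact: torsion3_ext1 hS hD.
- exact: torsion3_sasaki hS hD.
- exact: cov3_torsion3 hS hD.
- exact: ext3_torsion3 hS hD.
- exact: ext3_torsion3_hor hS hD.
Qed.
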